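(* Let $A, B \in \mathbb{C}^{m\times n}$ with $a=\mathrm{rk}(A)$, $b=\mathrm{rk}(B)$, and $b>a\geq 1$. The following statements are equivalent: (a) $A \leq^\diamond B$. (b) There exist unitary matrices $U\in\mathbb{C}^{m\times m}$ and $V\in\mathbb{C}^{n\times n}$, a positive definite diagonal matrix $\Lambda_a\in\mathbb{C}^{a\times a}$, nonsingular matrices $Z\in\mathbb{C}^{(b-a)\times(b-a)}$ and $\Gamma\in\mathbb{C}^{b\times b}$, and matrices $L_1\in\mathbb{C}^{a\times(b-a)}$, $L_2\in\mathbb{C}^{(b-a)\times a}$ such that $$A=U\,\mathrm{diag}(\Lambda_a,0_{b-a},0)\,V^*,\qquad B=U\,\mathrm{diag}(\Gamma,0)\,V^*,\qquad \Gamma=\begin{pmatrix}\Lambda_a & L_1\\ L_2 & Z^{-1}+L_2\Lambda_a^{-1}L_1\end{pmatrix}.$$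
   Context: $A^*$ is the conjugate transpose, $\mathrm{rk}$ the rank and $\mathcal{R}(\cdot)$ the range (column space) of a complex matrix. The diamond partial order on $\mathbb{C}^{m\times n}$ is defined by: $A\leq^\diamond B$ iff $\mathcal{R}(A)\subseteq\mathcal{R}(B)$, $\mathcal{R}(A^* )\subseteq\mathcal{R}(B^* )$ and $AB^*A=AA^*A$. Here $\mathrm{diag}(\cdot)$ denotes a block diagonal $m\times n$ matrix, $0_{b-a}$ is the $(b-a)\times(b-a)$ zero matrix, and the final $0$ block has size $(m-b)\times(n-b)$ (possibly empty). *)

(* Defs.v *)
From mathcomp Require Import all_boot all_order all_algebra.
From mathcomp Require Import spectral classical_sets reals.
From mathcomp.real_closed Require Export complex.

Set Implicit Arguments.
Unset Strict Implicit.
Unset Printing Implicit Defensive.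

Import GRing.Theory Num.Theory.
Local Open Scope ring_scope.
Local Open Scope sesquilinear_scope.
Local Open Scope classical_set_scope.

Definition colrange (F : fieldType) m n (A : 'M[F]_(m, n)) : set 'cV[F]_m :=
  range (fun x : 'cV[F]_n => A *m x).

(* MathComp's [<=%MS] compares row spaces, hence the transposes. *)
Lemma colrange_subP (F : fieldType) m n p
    (A : 'M[F]_(m, n)) (B : 'M[F]_(m, p)) :
  colrange A `<=` colrange B <-> (A^T <= B^T)%MS.
Proof.
split=> [sAB | /submxP[D defA] _ [x _ <-]].
  apply/row_subP => i.
  have [|y _ Ey] := sAB (A *m delta_mx i 0); first by exists (delta_mx i 0).
  apply/submxP; exists y^T.
  by rewrite -trmx_mul Ey trmx_mul trmx_delta -rowE.
exists (D^T *m x) => //=; rewrite mulmxA; congr (_ *m _).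
by apply: trmx_inj; rewrite trmx_mul trmxK.
Qed.

Definition diamond_le (C : numClosedFieldType) m n (A B : 'M[C]_(m, n)) : Prop :=
  [/\ colrange A `<=` colrange B,
      colrange (A ^t*) `<=` colrange (B ^t*)
    & A *m B ^t* *m A = A *m A ^t* *m A].

(* On a numClosedFieldType, [0 < z] entails that [z] is real. *)
Definition posdefmx (C : numClosedFieldType) n (M : 'M[C]_n) : Prop :=
  M ^t* = M /\ forall x : 'cV[C]_n, x != 0 -> 0 < (x ^t* *m M *m x) 0 0.

(* The m x n matrix diag(G, 0); the casts only identify b + (m - b) with m
   and b + (n - b) with n. *)
Definition diag0_mx (F : fieldType) m n b (bm : (b <= m)%N) (bn : (b <= n)%N)
    (G : 'M[F]_b) : 'M[F]_(m, n) :=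
  castmx (subnKC bm, subnKC bn)
    (block_mx G 0 0 (0 : 'M[F]_(m - b, n - b))).

(* The 2 x 2 block matrix with diagonal blocks of sizes a and b - a, as a
   matrix of size b. *)
Definition split_block_mx (F : fieldType) a b (ab : (a <= b)%N)
    (P : 'M[F]_a) (Q : 'M[F]_(a, b - a))
    (R : 'M[F]_(b - a, a)) (S : 'M[F]_(b - a)) : 'M[F]_b :=
  castmx (subnKC ab, subnKC ab) (block_mx P Q R S).

(* Main.v *)
(* A singular value decomposition gives [A = P1^* Lambda Q1], where the [a] rows
   of [P1] and of [Q1] are orthonormal. The range conditions say that the rows
   of [P1] and [Q1] lie in the row spaces of [B^*] and [B]; completing them
   there to orthonormal bases [P] and [Q] yields [B = P^* Gamma Q] with [Gamma]
   invertible of size [b], and [A B^* A = A A^* A] then says precisely that the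
   top left block [P1 B Q1^*] of [Gamma] is [Lambda]. The Schur complement of
   [Lambda] in [Gamma] is [Z^-1]. *)
Require Import Defs.
From mathcomp Require Import all_boot all_order all_algebra.
From mathcomp Require Import spectral reals.

Set Implicit Arguments.
Unset Strict Implicit.
Unset Printing Implicit Defensive.

Import Order.TTheory GRing.Theory Num.Theory.
Local Open Scope ring_scope.
Local Open Scope sesquilinear_scope.

(** * Conjugate transposes and positive definiteness *)

Section ConjugateTranspose.
Variable C : numClosedFieldType.

Lemma trmxC_mul m n p (A : 'M[C]_(m, n)) (B : 'M[C]_(n, p)) :
  (A *m B)^t* = B^t* *m A^t*.
Proof. by rewrite trmx_mul map_mxM. Qed.

Lemma trmxC0 m n : (0 : 'M[C]_(m, n))^t* = 0.
Proof. by rewrite trmx0 map_mx0. Qed.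

Lemma trmxC_pid m n r : (pid_mx r : 'M[C]_(m, n))^t* = pid_mx r.
Proof. by rewrite tr_pid_mx map_pid_mx. Qed.

Lemma trmxC_submx m n p (A : 'M[C]_(m, n)) (B : 'M[C]_(m, p)) :
  (A^t* <= B^t*)%MS = (A^T <= B^T)%MS.
Proof. by rewrite map_submx. Qed.

Lemma mxrank_trmxC m n (A : 'M[C]_(m, n)) : \rank (A^t*) = \rank A.
Proof. by rewrite mxrank_map mxrank_tr. Qed.

Lemma trmxC_diag_mx n (D : 'rV[C]_n) :
  (forall i, 0 < D 0 i) -> (diag_mx D)^t* = diag_mx D.
Proof.
move=> D_gt0; rewrite tr_diag_mx map_diag_mx; congr diag_mx.
by apply/rowP=> i; rewrite mxE; apply/CrealP/gtr0_real.
Qed.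

Lemma mulmx_trmxC_gt0 n (x : 'cV[C]_n) : x != 0 -> 0 < (x^t* *m x) 0 0.
Proof.
move=> x0; rewrite -[x in _ *m x]trmxCK -dotmxE (dnorm_gt0 (@dotmx C n)).
by apply: contra_neq x0 => /(congr1 (fun y => y^t*)); rewrite trmxCK trmxC0.
Qed.

(** With [S] the diagonal of square roots, the quadratic form at [x] is the squared norm of
    [S *m x]. *)
Lemma posdef_diag_mx n (D : 'rV[C]_n) :
  (forall i, 0 < D 0 i) -> posdefmx (diag_mx D).
Proof.
move=> D_gt0; split=> [|x x0]; first exact: trmxC_diag_mx.
pose S := diag_mx (\row_i sqrtC (D 0 i)).
have Sh : S^t* = S by apply: trmxC_diag_mx => i; rewrite mxE sqrtC_gt0.
have -> : diag_mx D = S^t* *m S.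
  rewrite Sh mulmx_diag; congr diag_mx.
  by apply/rowP=> i; rewrite !mxE -expr2 sqrtCK.
rewrite mulmxA -trmxC_mul -mulmxA; apply: mulmx_trmxC_gt0.
apply: contra_neq x0 => Sx0; apply/colP=> i; have /colP/(_ i) := Sx0.
rewrite mul_diag_mx !mxE => /eqP; rewrite mulf_eq0 sqrtC_eq0.
by rewrite gt_eqF //= => /eqP.
Qed.

Lemma posdef_unit n (M : 'M[C]_n) : posdefmx M -> M \in unitmx.
Proof.
move=> [_ M_gt0]; rewrite -row_free_unit -kermx_eq0; apply: contraT.
move=> /rowV0Pn[v /sub_kermxP vM0 v0].
have vc0 : v^t* != 0.
  by apply: contra_neq v0 => /(congr1 (fun y => y^t*)); rewrite trmxCK trmxC0.
by have := M_gt0 _ vc0; rewrite trmxCK vM0 mul0mx mxE ltxx.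
Qed.

End ConjugateTranspose.

(** * Orthonormal bases and singular values; a rectangular [unitarymx] has orthonormal rows *)

Section OrthonormalBases.
Variable C : numClosedFieldType.

Lemma orthonormal_row_base p n r (M : 'M[C]_(p, n)) : \rank M = r ->
  exists2 P : 'M[C]_(r, n), P \is unitarymx & (P :=: M)%MS.
Proof.
move=> <-; exists (schmidt (row_base M)).
  by apply: schmidt_unitarymx; exact: rank_leq_col.
apply: eqmx_trans (eq_row_base M).
by apply: eqmx_schmidt_free; exact: row_base_free.
Qed.

(** [P^t* *m P] is the orthogonal projection onto the row space of [P]. *)
Lemma unitarymx_proj m n p (M : 'M[C]_(p, n)) (P : 'M[C]_(m, n)) :
  P \is unitarymx -> (M <= P)%MS -> M *m P^t* *m P = M.
Proof. by move=> Pu /submxP[D ->]; rewrite mulmxtVK. Qed.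

Lemma unitarymx_complete r n (Q : 'M[C]_(r, n)) : Q \is unitarymx ->
  exists2 X : 'M[C]_n, X \is unitarymx & pid_mx r *m X = Q.
Proof.
move=> Qu.
(* This kernel is the orthogonal complement of the row space of [Q]; stacking [Q] on [S] gives
   [X]. *)
have [S Su SK] := orthonormal_row_base (erefl (\rank (kermx (Q^t*)))).
have rkn : (r + \rank (kermx (Q^t*)) = n)%N.
  by rewrite mxrank_ker mxrank_trmxC mxrank_unitary // subnKC //
             -{1}(mxrank_unitary Qu) rank_leq_col.
have SQ0 : S *m Q^t* = 0 by apply/sub_kermxP; rewrite SK.
have QS0 : Q *m S^t* = 0.
  by apply: (can_inj (@trmxCK _ _ _)); rewrite trmxC_mul trmxCK SQ0 trmxC0.
have [X Xu QX] : exists2 X : 'M[C]_(r + \rank (kermx (Q^t*)), n),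
    X \is unitarymx & pid_mx r *m X = Q.
  exists (col_mx Q S).
    apply/unitarymxP; rewrite tr_col_mx map_row_mx mul_col_row.
    by rewrite !(unitarymxP _) // SQ0 QS0 -scalar_mx_block.
  by rewrite pid_mx_row mul_row_col mul1mx mul0mx addr0.
by case: _ / (esym rkn) X Xu QX => X Xu QX; exists X.
Qed.

Lemma orthonormal_row_base_extend a b p n (Q : 'M[C]_(a, n)) (M : 'M[C]_(p, n)) :
    Q \is unitarymx -> (Q <= M)%MS -> \rank M = b ->
  exists P : 'M[C]_(b, n),
    [/\ P \is unitarymx, (P :=: M)%MS & pid_mx a *m P = Q].
Proof.
move=> Qu QM rkM; have [P0 P0u P0M] := orthonormal_row_base rkM.
have /submxP[T QE] : (Q <= P0)%MS by rewrite P0M.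
(* Coordinates in the orthonormal basis [P0] preserve inner products, so completing [T] in dimension
   [b] amounts to completing [Q] inside the row space of [M]. *)
have Tu : T \is unitarymx.
  apply/unitarymxP; rewrite -(unitarymxP Qu) QE trmxC_mul mulmxA.
  by rewrite mulmxtVK.
have [X Xu XT] := unitarymx_complete Tu.
exists (X *m P0); split; first exact: mul_unitarymx.
  apply: eqmx_trans P0M; apply: eqmxMfull.
  by rewrite row_full_unit unitarymx_unit.
by rewrite mulmxA XT.
Qed.

(** Factor [A = T *m Q0] over an orthonormal basis of its row space and diagonalize the positive
    definite [T^t* *m T] by a unitary [W]. The singular values are the square roots of its
    eigenvalues. *)
Lemma thin_svd m n a (A : 'M[C]_(m, n)) : \rank A = a ->
  exists (P : 'M[C]_(a, m)) (D : 'rV[C]_a) (Q : 'M[C]_(a, n)),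
    [/\ P \is unitarymx, Q \is unitarymx, forall i, 0 < D 0 i
      & A = P^t* *m diag_mx D *m Q].
Proof.
move=> rkA; have [Q0 Q0u Q0A] := orthonormal_row_base rkA.
have /submxP[T AT] : (A <= Q0)%MS by rewrite Q0A.
have rkT : \rank (T^t*) = a.
  rewrite mxrank_trmxC; apply/eqP; rewrite eqn_leq rank_leq_col /=.
  by apply: leq_trans (eq_leq (esym rkA)) _; rewrite AT mxrankM_maxl.
have /orthomx_spectralP : T^t* *m T \is normalmx.
  by apply/normalmxP; rewrite trmxC_mul trmxCK.
rewrite invmx_unitary ?spectral_unitarymx //.
set W := spectralmx _; set E := spectral_diag _ => TE.
have Wu : W \is unitarymx by exact: spectral_unitarymx.
have WE : W *m (T^t* *m T) *m W^t* = diag_mx E.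
  by rewrite TE !mulmxA (unitarymxP Wu) mul1mx mulmxtVK.
(* The eigenvalue is the squared norm of [T] applied to a unit eigenvector, nonzero because [T] has
   full column rank. *)
have E_gt0 i : 0 < E 0 i.
  pose e : 'cV[C]_a := delta_mx i 0.
  have -> : E 0 i = ((T *m W^t* *m e)^t* *m (T *m W^t* *m e)) 0 0.
    transitivity ((e^t* *m (W *m (T^t* *m T) *m W^t*) *m e) 0 0).
      by rewrite WE trmx_delta map_delta_mx -rowE -colE !mxE eqxx mulr1n.
    by rewrite !trmxC_mul trmxCK !mulmxA.
  apply: mulmx_trmxC_gt0; apply/eqP.
  have Tfree : row_free (T^t*) by rewrite /row_free rkT.
  rewrite -mulmxA => /(congr1 (fun y => y^t*)); rewrite trmxC_mul trmxC0.
  move/eqP; rewrite mulmx_free_eq0 // trmxC_mul trmxCK => /eqP.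
  move/(congr1 (fun y => y *m W^t*)); rewrite mulmxtVK // mul0mx.
  rewrite trmx_delta map_delta_mx => /matrixP/(_ 0 i)/eqP.
  by rewrite !mxE !eqxx oner_eq0.
pose D := \row_i sqrtC (E 0 i).
have D_gt0 i : 0 < D 0 i by rewrite mxE sqrtC_gt0.
have Dh := trmxC_diag_mx D_gt0; have Dunit := posdef_unit (posdef_diag_mx D_gt0).
have DD : diag_mx E = diag_mx D *m diag_mx D.
  by rewrite mulmx_diag; congr diag_mx; apply/rowP=> i; rewrite !mxE -expr2 sqrtCK.
have Dih : (invmx (diag_mx D))^t* = invmx (diag_mx D).
  by rewrite trmx_inv map_invmx Dh.
exists (invmx (diag_mx D) *m W *m T^t*), D, (W *m Q0); split=> //.
- apply/unitarymxP; rewrite !trmxC_mul trmxCK Dih.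
  rewrite !mulmxA -[_ *m T^t* *m T]mulmxA -[_ *m W *m _]mulmxA.
  rewrite -[_ *m (_ *m _) *m _]mulmxA WE DD mulmxA.
  by rewrite mulVmx // mul1mx mulmxV.
- exact: mul_unitarymx.
- rewrite !trmxC_mul trmxCK Dih !mulmxA mulmxKV //.
  by rewrite (mulmxKtV _ Wu) // -AT.
Qed.

End OrthonormalBases.

(** * Block matrices, with [pid_mx] products in place of casts *)

Section BlockMatrices.
Variable F : fieldType.

Lemma diag0_mxE m n b (bm : (b <= m)%N) (bn : (b <= n)%N) (G : 'M[F]_b) :
  diag0_mx bm bn G = pid_mx b *m G *m pid_mx b.
Proof.
(* Once the differences are variables, the dimension equations can be eliminated and the cast
   disappears. *)
rewrite /diag0_mx; move: (subnKC bm) (subnKC bn).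
move: (m - b)%N (n - b)%N => p q em en.
case: m / em bm => _; case: n / en bn => _.
rewrite castmx_id pid_mx_col pid_mx_row mul_col_mx mul_col_row.
by rewrite mul1mx mul0mx mulmx1 mul0mx !mulmx0.
Qed.

Lemma pid_split_block_mx a b (ab : (a <= b)%N) P Q R (S : 'M[F]_(b - a)) :
  pid_mx a *m split_block_mx ab P Q R S *m pid_mx a = P.
Proof.
rewrite /split_block_mx; move: (subnKC ab) Q R S.
move: (b - a)%N => k e; case: b / e ab => _ Q R S.
rewrite castmx_id pid_mx_row pid_mx_col mul_row_block mul_row_col.
by rewrite !mul1mx !mul0mx !addr0 mulmx1 mulmx0 addr0.
Qed.

Lemma split_block_mxP a b (ab : (a <= b)%N) (G : 'M[F]_b) :
  exists Q R S, G = split_block_mx ab (pid_mx a *m G *m pid_mx a) Q R S.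
Proof.
rewrite /split_block_mx; move: (subnKC ab).
move: (b - a)%N => k e; case: b / e ab G => _ G.
exists (ursubmx G), (dlsubmx G), (drsubmx G).
rewrite castmx_id -{1}[G]submxK; congr block_mx.
rewrite pid_mx_row pid_mx_col -{2}[G]submxK mul_row_block mul_row_col.
by rewrite !mul1mx !mul0mx !addr0 mulmx1 mulmx0 addr0.
Qed.

Lemma schur_complement_unit a b (ab : (a <= b)%N) P Q R (S : 'M[F]_(b - a)) :
    P \in unitmx -> split_block_mx ab P Q R S \in unitmx ->
  S - R *m invmx P *m Q \in unitmx.
Proof.
rewrite /split_block_mx; move: (subnKC ab) Q R S.
move: (b - a)%N => k e; case: b / e ab => _ Q R S Pu.
(* Block Gaussian elimination: the determinant is that of [P] times that of the Schur complement. *)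
have -> : block_mx P Q R S = block_mx 1%:M 0 (R *m invmx P) 1%:M *m
                             block_mx P Q 0 (S - R *m invmx P *m Q).
  rewrite mulmx_block !mul1mx !mul0mx !addr0 mulmxKV //.
  by rewrite addrC subrK.
by rewrite castmx_id unitmxE det_mulmx det_lblock det_ublock !det1 !mul1r
           unitrM => /andP[_].
Qed.

End BlockMatrices.

(** * The diamond order in terms of row spaces and orthonormal factors *)

Section DiamondOrder.
Variable C : numClosedFieldType.

(** Only the first [b] columns of [U] and [V] survive, so square unitary factors reduce to
    rectangular ones. *)
Lemma mul_diag0_mx m n b (bm : (b <= m)%N) (bn : (b <= n)%N) (G : 'M[C]_b)
    (U : 'M[C]_m) (V : 'M[C]_n) :
  U *m diag0_mx bm bn G *m V^t* =
  (pid_mx b *m U^t*)^t* *m G *m (pid_mx b *m V^t*).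
Proof. by rewrite diag0_mxE trmxC_mul trmxCK trmxC_pid !mulmxA. Qed.

Lemma unitarymx_pid a b m (U : 'M[C]_(b, m)) : (a <= b)%N -> U \is unitarymx ->
  pid_mx a *m U \is @unitarymx C a m.
Proof.
move=> ab Uu; apply: mul_unitarymx => //.
by apply/unitarymxP; rewrite trmxC_pid pid_mx_id // pid_mx_1.
Qed.

Lemma diamond_leP m n (A B : 'M[C]_(m, n)) :
  diamond_le A B <-> [/\ (A^t* <= B^t*)%MS, (A <= B)%MS
                       & A *m B^t* *m A = A *m A^t* *m A].
Proof.
rewrite /diamond_le trmxC_submx; split=> [[]|[]].
  by move=> /colrange_subP ? /colrange_subP; rewrite -!map_trmx !trmxK map_submx.
move=> ? ? ?; split=> //; first exact/colrange_subP.
by apply/colrange_subP; rewrite -!map_trmx !trmxK map_submx.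
Qed.

Lemma svd_diamond_eq m n a (P : 'M[C]_(a, m)) (Q : 'M[C]_(a, n)) (L : 'M[C]_a)
    (A B : 'M[C]_(m, n)) :
    P \is unitarymx -> Q \is unitarymx -> L \in unitmx ->
    A = P^t* *m L *m Q ->
  A *m B^t* *m A = A *m A^t* *m A <-> P *m B *m Q^t* = L.
Proof.
move=> Pu Qu Lu AE.
(* [A *m X^t* *m A] depends on [X] only through [P *m X *m Q^t*], and determines it since [L] is
   invertible. *)
have sandwich (X : 'M[C]_(m, n)) :
    A *m X^t* *m A = P^t* *m (L *m (P *m X *m Q^t*)^t* *m L) *m Q.
  by rewrite AE !trmxC_mul trmxCK !mulmxA.
have PAQ : P *m A *m Q^t* = L.
  by rewrite AE !mulmxA (unitarymxP Pu) mul1mx mulmxtVK.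
rewrite !sandwich PAQ; split=> [|-> //].
move=> /(congr1 (fun X => P *m X *m Q^t*)).
rewrite !mulmxA (unitarymxP Pu) !mul1mx !mulmxtVK //.
move=> /(congr1 (fun X => invmx L *m (X *m invmx L))).
rewrite !mulmxK // !mulKmx // => /(congr1 (fun X => X^t*)).
by rewrite !trmxCK.
Qed.

End DiamondOrder.

Theorem theorem2p1 (R : realType) (m n : nat) (A B : 'M[R[i]]_(m, n))
    (ha : (1 <= \rank A)%N) (hab : (\rank A < \rank B)%N) :
  diamond_le A B <->
  exists (U : 'M[R[i]]_m) (V : 'M[R[i]]_n)
         (Lambda : 'M[R[i]]_(\rank A))
         (Z : 'M[R[i]]_(\rank B - \rank A))
         (Gamma : 'M[R[i]]_(\rank B))
         (L1 : 'M[R[i]]_(\rank A, \rank B - \rank A))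
         (L2 : 'M[R[i]]_(\rank B - \rank A, \rank A)),
    (U \is unitarymx /\ V \is unitarymx) /\
    (is_diag_mx Lambda /\ posdefmx Lambda) /\
    (Z \in unitmx /\ Gamma \in unitmx) /\
    A = U *m diag0_mx (rank_leq_row B) (rank_leq_col B)
               (split_block_mx (ltnW hab) Lambda 0 0 0) *m V ^t* /\
    B = U *m diag0_mx (rank_leq_row B) (rank_leq_col B) Gamma *m V ^t* /\
    Gamma = split_block_mx (ltnW hab)
              Lambda L1
              L2     (invmx Z + L2 *m invmx Lambda *m L1).
Proof.
rewrite diamond_leP.
(* With the ranks as variables, [A] and [B] no longer occur in the dimensions
   and can be rewritten. *)
have [a rkA] : exists a, \rank A = a by exists (\rank A).
have [b rkB] : exists b, \rank B = b by exists (\rank B).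
move: (ltnW hab) (rank_leq_row B) (rank_leq_col B) => {ha hab}.
rewrite rkA rkB => ab bm bn.
have split_diag (L : 'M[R[i]]_a) :
    split_block_mx ab L 0 0 0 = pid_mx a *m L *m pid_mx a.
  exact: (diag0_mxE ab ab).
split=> [[sAB sAB' eqA]|]; last first.
  (* From the factorization to the order: invertibility of [G] puts the rows of [P] and [Q] in the
     row spaces of [B^t*] and [B]. *)
  move=> [U [V [L [Z [G [L1 [L2 [[Uu Vu] [[Ldiag Lpd] [[Zu Gu] [AE [BE GE]]]]]]]]]]]].
  move: AE BE; rewrite !mul_diag0_mx.
  have Pu : pid_mx b *m U^t* \is @unitarymx _ b m.
    by apply: unitarymx_pid; rewrite ?trmxC_unitary.
  have Qu : pid_mx b *m V^t* \is @unitarymx _ b n.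
    by apply: unitarymx_pid; rewrite ?trmxC_unitary.
  move: (pid_mx _ *m U^t*) (pid_mx _ *m V^t*) Pu Qu => P Q Pu Qu AE BE.
  have AE' : A = (pid_mx a *m P)^t* *m L *m (pid_mx a *m Q).
    by rewrite AE split_diag trmxC_mul trmxC_pid !mulmxA.
  have BQ : P *m B *m Q^t* = G.
    by rewrite BE !mulmxA (unitarymxP Pu) mul1mx mulmxtVK.
  have PB : P^t* = B *m Q^t* *m invmx G.
    by rewrite BE mulmxtVK // mulmxK.
  have QB : Q = invmx G *m P *m B.
    by rewrite BE -!mulmxA [P *m _]mulmxA (unitarymxP Pu) mul1mx mulKmx.
  have idP : pid_mx a *m P \is @unitarymx _ a m by exact: unitarymx_pid.
  have idQ : pid_mx a *m Q \is @unitarymx _ a n by exact: unitarymx_pid.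
  have Lu : L \in unitmx by exact: posdef_unit.
  split.
  - rewrite AE PB !trmxC_mul !mulmxA; exact: submxMl.
  - rewrite AE QB !mulmxA; exact: submxMl.
  - apply/(svd_diamond_eq _ idP idQ Lu AE').
    by rewrite trmxC_mul trmxC_pid !mulmxA -[_ *m P *m B]mulmxA
               -[_ *m (P *m B) *m _]mulmxA BQ GE pid_split_block_mx.
(* From the order to the factorization. *)
have [P1 [D [Q1 [P1u Q1u D_gt0 AE]]]] := thin_svd rkA.
have Dunit := posdef_unit (posdef_diag_mx D_gt0).
have P1B : (P1 <= B^t*)%MS.
  apply: submx_trans sAB.
  have -> : P1 = invmx (diag_mx D) *m Q1 *m A^t*.
    rewrite AE !trmxC_mul trmxCK trmxC_diag_mx // !mulmxA mulmxtVK //.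
    by rewrite mulVmx // mul1mx.
  exact: submxMl.
have Q1B : (Q1 <= B)%MS.
  apply: submx_trans sAB'.
  have -> : Q1 = invmx (diag_mx D) *m P1 *m A.
    rewrite AE !mulmxA -[_ *m P1 *m _]mulmxA (unitarymxP P1u) mulmx1.
    by rewrite mulVmx // mul1mx.
  exact: submxMl.
have [P [Pu PB idP]] := orthonormal_row_base_extend P1u P1B (etrans (mxrank_trmxC B) rkB).
have [Q [Qu QB idQ]] := orthonormal_row_base_extend Q1u Q1B rkB.
have [U Uu UP] := unitarymx_complete Pu.
have [V Vu VQ] := unitarymx_complete Qu.
pose G := P *m B *m Q^t*.
(* Projecting onto the row spaces of [Q] and [P] fixes [B] and [B^t*] respectively. *)
have BE : B = P^t* *m G *m Q.
  rewrite /G !mulmxA unitarymx_proj //; last first.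
    by rewrite QB; exact: submxMl.
  apply: (can_inj (@trmxCK _ _ _)); rewrite !trmxC_mul trmxCK mulmxA.
  by rewrite unitarymx_proj // PB.
(* By [BE], the rank [b] of [B] is at most that of [G]. *)
have Gu : G \in unitmx.
  rewrite -row_free_unit /row_free eqn_leq rank_leq_row /=.
  apply: leq_trans (eq_leq (esym rkB)) _.
  rewrite [X in (\rank X <= _)%N]BE -mulmxA.
  by rewrite (leq_trans (mxrankM_maxr _ _)) // mxrankM_maxl.
have G11 : pid_mx a *m G *m pid_mx a = diag_mx D.
  rewrite -((svd_diamond_eq B P1u Q1u Dunit AE).1 eqA) -idP -idQ.
  by rewrite trmxC_mul trmxC_pid /G !mulmxA.
have [L1 [L2 [S GE]]] := split_block_mxP ab G.
rewrite G11 in GE.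
have Su : S - L2 *m invmx (diag_mx D) *m L1 \in unitmx.
  by apply: schur_complement_unit Dunit _; rewrite -GE.
(* The completions have [P] and [Q] as first rows, whereas the factorization needs [P^t*] as first
   columns of its left factor, hence the adjoints. *)
exists (U^t*), (V^t*), (diag_mx D), (invmx (S - L2 *m invmx (diag_mx D) *m L1)).
exists G, L1, L2.
rewrite !trmxC_unitary unitmx_inv invmxK subrK !mul_diag0_mx !trmxCK UP VQ.
split=> //; split; first by split; [exact: diag_mx_is_diag | exact: posdef_diag_mx].
split; first by [].
split; last by [].
by rewrite split_diag AE -idP -idQ trmxC_mul trmxC_pid !mulmxA.
Qed.
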